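(* Let $\{\overline{\mathbf U}^n_{j+\frac12}\}_{j\in\mathbb Z}$ be cell averages and $\{\mathbf U^n_j\}_{j\in\mathbb Z}$ be endpoint point values at time level $n$, let $\mathbf U^n_{j+\frac12}$ be the midpoint values determined by $\mathbf U^n_{j+\frac12}=\frac32\overline{\mathbf U}^n_{j+\frac12}-\frac14(\mathbf U^n_j+\mathbf U^n_{j+1})$, and let $\overline{\mathbf U}^{n+1}_{j+\frac12}$ be given by the PAMPA cell-average update with continuous flux, $$\overline{\mathbf U}^{n+1}_{j+\frac12}=\overline{\mathbf U}^{n}_{j+\frac12}-\frac{\Delta t^n}{\Delta x_{j+\frac12}}\Big(\mathbf F(\mathbf U^n_{j+1})-\mathbf F(\mathbf U^n_j)\Big),\qquad j\in\mathbb Z.$$ Suppose that for every cell $j$ one has $\overline{\mathbf U}^n_{j+\frac12}\in G$ and $$\mathbf U^n_j,\ \mathbf U^n_{j+\frac12},\ \mathbf U^n_{j+1}\in G .$$ Then, under the CFL condition $$\lambda_{\max}(\mathbf U^n_j,\mathbf U^n_{j+1})\,\frac{\Delta t^n}{\Delta x_{j+\frac12}}\le\frac16\qquad\text{for every } j,$$ one has $\overline{\mathbf U}^{n+1}_{j+\frac12}\in G$ for every $j$.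
   Context: Consider a one-dimensional hyperbolic system of conservation laws $\partial_t\mathbf U+\partial_x\mathbf F(\mathbf U)=\mathbf 0$ with $\mathbf U\in\mathbb R^d$, and let $G\subset\mathbb R^d$ be a convex set (invariant domain), with flux $\mathbf F:G\to\mathbb R^d$. The line is divided into cells $I_{j+\frac12}=[x_j,x_{j+1}]$ of size $\Delta x_{j+\frac12}=x_{j+1}-x_j>0$ (not necessarily uniform), and $\Delta t^n>0$ is the time step. Standing assumption (generalized Lax--Friedrichs splitting property): there is a wave speed estimate $\lambda_{\max}:G\times G\to[0,\infty)$ such that for all $\mathbf U_L,\mathbf U_R\in G$, $$\frac{\mathbf U_L+\mathbf U_R}{2}-\frac1{2\lambda}\big(\mathbf F(\mathbf U_R)-\mathbf F(\mathbf U_L)\big)\in G\qquad\text{for all }\lambda\ge\lambda_{\max}(\mathbf U_L,\mathbf U_R),\ \lambda>0 .$$ *)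

(* Defs.v *)
From mathcomp Require Import all_boot all_order all_algebra.
From mathcomp Require Import boolp classical_sets set_interval reals convex.

Set Implicit Arguments.
Unset Strict Implicit.
Unset Printing Implicit Defensive.

Import Order.TTheory GRing.Theory Num.Theory.
Local Open Scope classical_set_scope.
Local Open Scope ring_scope.

(* A family indexed by j + 1/2 (cells, cell averages, midpoint values) is
   represented as a function of j : int. *)

Section Mesh.
Context {R : realType}.
Implicit Type x : int -> R.

Definition cell x (j : int) : set R := `[x j, x (j + 1)]%classic.

Definition cell_size x (j : int) : R := x (j + 1) - x j.

(* The covering condition excludes nodes that accumulate at a finite point. *)
Definition mesh x : Prop :=
  (forall j : int, 0 < cell_size x j) /\
  \bigcup_(j in [set: int]) cell x j = [set: R].

End Mesh.

Section Pampa.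
Context {R : realType} {d : nat}.

(* F and lambda_max are total functions, but only their values on the
   invariant domain G matter. *)
Definition wave_speed_estimate (G : set 'rV[R]_d)
    (lambda_max : 'rV[R]_d -> 'rV[R]_d -> R) : Prop :=
  forall UL UR : 'rV[R]_d, G UL -> G UR -> 0 <= lambda_max UL UR.

Definition generalized_LF_splitting (G : set 'rV[R]_d) (F : 'rV[R]_d -> 'rV[R]_d)
    (lambda_max : 'rV[R]_d -> 'rV[R]_d -> R) : Prop :=
  forall UL UR : 'rV[R]_d, G UL -> G UR ->
  forall lambda : R, lambda_max UL UR <= lambda -> 0 < lambda ->
  G (2^-1 *: (UL + UR) - (2 * lambda)^-1 *: (F UR - F UL)).

Definition pampa_midpoint (Ubar U : int -> 'rV[R]_d) (j : int) : 'rV[R]_d :=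
  (3 / 2) *: Ubar j - 4^-1 *: (U j + U (j + 1)).

Definition pampa_average_update (F : 'rV[R]_d -> 'rV[R]_d) (x : int -> R) (dt : R)
    (Ubar U : int -> 'rV[R]_d) (j : int) : 'rV[R]_d :=
  Ubar j - (dt / cell_size x j) *: (F (U (j + 1)) - F (U j)).

End Pampa.

(* Main.v *)
Require Import Defs.
From mathcomp Require Import all_boot all_order all_algebra.
From mathcomp Require Import boolp classical_sets set_interval reals convex.
From mathcomp Require Import interval_inference ring lra.
Import Order.TTheory GRing.Theory Num.Theory.
Local Open Scope classical_set_scope.
Local Open Scope ring_scope.

(** Applied with the endpoint values, Simpson's rule makes each cell average a
    convex combination of point values, with weight [2/3] on the midpoint and
    [1/6] on each endpoint; this is the defining relation of the midpoint value
    solved for the average. The flux difference in the update involves the two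
    endpoints only, so it can be charged entirely to their joint weight [1/3].
    With [r] the mesh ratio [dt / cell_size x j], the new average is
    [[
      2/3 Umid + 1/3 ( (UL + UR) / 2 - 3 r (F UR - F UL) ),
    ]]
    and the bracket is the Lax--Friedrichs splitting state for the speed
    [lambda = 1 / (6 r)], since then [1 / (2 lambda) = 3 r]. The CFL condition
    says exactly that this speed dominates [lambda_max UL UR], so the bracket
    lies in [G]; so does the midpoint value, and convexity concludes. Thus the
    bound [1/6] is the Simpson weight of an endpoint. *)

Lemma convex_set_comb (R : realType) (M : lmodType R) (G : set M) (t : R)
    (u v : M) :
  convex_set G -> 0 <= t -> t <= 1 -> G u -> G v ->
  G (t *: u + (1 - t) *: v).
Proof.
move=> cG t0 t1 Gu Gv.
by have /set_mem := cG u v (Itv01 t0 t1) (mem_set Gu) (mem_set Gv).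
Qed.

(** This isolates the choice of speed: it identifies the mesh ratio [r] as
    [1 / (6 lambda)] and moves the whole flux difference into the endpoint
    state of weight [1/3]. *)
Lemma pampa_update_split (R : realType) (d : nat) (F : 'rV[R]_d -> 'rV[R]_d)
    (x : int -> R) (dt : R) (Ubar U : int -> 'rV[R]_d) (j : int) :
  let r := dt / cell_size x j in
  let lambda := (6 * r)^-1 in
  r != 0 ->
  pampa_average_update F x dt Ubar U j =
  (2 / 3) *: pampa_midpoint Ubar U j +
  (1 - 2 / 3) *: (2^-1 *: (U j + U (j + 1)) -
                  (2 * lambda)^-1 *: (F (U (j + 1)) - F (U j))).
Proof.
move=> r lambda r0; rewrite /pampa_average_update /pampa_midpoint -/r.
have -> : (2 * lambda)^-1 = 3 * r by rewrite /lambda; field.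
by apply/rowP => i; rewrite !mxE; field.
Qed.

Theorem theorem4p1 (R : realType) (d : nat)
  (G : set 'rV[R]_d) (F : 'rV[R]_d -> 'rV[R]_d)
  (lambda_max : 'rV[R]_d -> 'rV[R]_d -> R)
  (x : int -> R) (dt : R)
  (Ubar U Umid Ubar_next : int -> 'rV[R]_d)
  (G_convex : convex_set G)
  (lambda_max_ge0 : wave_speed_estimate G lambda_max)
  (G_splitting : generalized_LF_splitting G F lambda_max)
  (x_mesh : mesh x)
  (dt_gt0 : 0 < dt)
  (UmidE : forall j : int, Umid j = pampa_midpoint Ubar U j)
  (Ubar_nextE : forall j : int,
    Ubar_next j = pampa_average_update F x dt Ubar U j)
  (Ubar_G : forall j : int, G (Ubar j))
  (U_G : forall j : int, [/\ G (U j), G (Umid j) & G (U (j + 1))])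
  (CFL : forall j : int,
    lambda_max (U j) (U (j + 1)) * (dt / cell_size x j) <= 1 / 6) :
  forall j : int, G (Ubar_next j).
Proof.
move=> j; have [UjG UmidG UjSG] := U_G j.
set r := dt / cell_size x j.
have r_gt0 : 0 < r by rewrite divr_gt0 //; case: x_mesh.
rewrite Ubar_nextE pampa_update_split ?gt_eqF // -UmidE.
apply: convex_set_comb => //; first by lra.
apply: G_splitting => //; last by rewrite invr_gt0 mulr_gt0.
rewrite -/r invfM ler_pdivlMr // -div1r.
exact: CFL.
Qed.
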